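(* Let $d\ge3$ be an integer and let $(\alpha,\beta)\in\overline\triangle$, with $\alpha$ or $\beta$ irrational, have triangle sequence $[d,d,d,\ldots]$. For $k\ge1$ let $\left(\frac{m_k}{s_k},\frac{n_k}{s_k}\right)$ be the rational pair defined by $$\begin{pmatrix} s_k \\ m_k \\ n_k \end{pmatrix}=\begin{pmatrix}1&d&1\\1&0&0\\0&1&0\end{pmatrix}^k\begin{pmatrix}2\\1\\0\end{pmatrix}.$$ Then $$\lim_{k\to\infty}s_k^\eta\left|\alpha-\frac{m_k}{s_k}\right|\left|\beta-\frac{n_k}{s_k}\right|=0$$ for all $\eta<2\left(1-\frac{\log|\lambda_1|}{\log\lambda_3}\right)$ if $d\ge4$, and for all $\eta<4$ if $d=3$.
   Context: $\triangle=\{(x,y)\in\mathbb R^2:1\ge x\ge y>0\}$, $\overline\triangle=\{1\ge x\ge y\ge0\}$. For $k\ge0$, $\triangle_k=\{(x,y)\in\triangle:1-x-ky\ge0>1-x-(k+1)y\}$, and the Triangle Map is $T:\triangle\to\overline\triangle$, $T(x,y)=\left(\frac yx,\frac{1-x-ky}x\right)$ for $(x,y)\in\triangle_k$. The point $(\alpha,\beta)$ has triangle sequence $[d,d,d,\ldots]$ if $T^j(\alpha,\beta)\in\triangle_d$ for all $j\ge0$. In this case it is known that $\beta=\alpha^2$ and that $\alpha\in(0,1)$ is the largest root of $P(t)=t^3+dt^2+t-1$, which for $d\ge3$ has three real roots $\alpha_1<\alpha_2<0<\alpha<1$. Put $\lambda_1=\frac1{\alpha_2}$, $\lambda_2=\frac1{\alpha_1}$,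 $\lambda_3=\frac1\alpha$; these are the eigenvalues of $\begin{pmatrix}1&d&1\\1&0&0\\0&1&0\end{pmatrix}$, and $\lambda_1<\lambda_2<0<1<\lambda_3$, $\lambda_3>|\lambda_1|\ge1>|\lambda_2|$. *)

(* Defs.v *)
From HB Require Import structures.
From mathcomp Require Import all_boot all_order all_algebra.
From mathcomp Require Import polyrcf.
From mathcomp Require Import all_classical all_reals all_analysis.

Set Implicit Arguments.
Unset Strict Implicit.
Unset Printing Implicit Defensive.

Import Order.TTheory GRing.Theory Num.Theory.
Import numFieldNormedType.Exports.

Local Open Scope classical_set_scope.
Local Open Scope ring_scope.

Section TriangleMap.
Context {R : realType}.
Implicit Types (p : R * R) (k d : nat).

Definition triangle : set (R * R) :=
  [set p | [/\ p.1 <= 1, p.2 <= p.1 & 0 < p.2]].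

Definition closed_triangle : set (R * R) :=
  [set p | [/\ p.1 <= 1, p.2 <= p.1 & 0 <= p.2]].

Definition triangle_k k : set (R * R) :=
  [set p | [/\ triangle p, 0 <= 1 - p.1 - k%:R * p.2
             & 1 - p.1 - (k%:R + 1) * p.2 < 0]].

(* The pieces [triangle_k k] partition [triangle]: on it, [triangle_index p] is
   the unique [k] with [triangle_k k p].  Off [triangle] it is the junk value 0. *)
Definition triangle_index p : nat := xget 0%N [set k | triangle_k k p].

Definition triangle_map p : R * R :=
  (p.2 / p.1, (1 - p.1 - (triangle_index p)%:R * p.2) / p.1).

(* The values of [triangle_map] off [triangle] are irrelevant here: the
   condition at [j] places the point to which the map is next applied in
   [triangle_k (a j)], hence in [triangle]. *)
Definition has_triangle_sequence p (a : nat -> nat) : Prop :=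
  forall j, triangle_k (a j) (iter j triangle_map p).

End TriangleMap.

Definition charP (R : realType) (d : nat) : {poly R} :=
  'X^3 + d%:R *: 'X^2 + 'X - 1.

(* [rootsR] lists the distinct real roots in increasing order; for [3 <= d]
   this is [:: alpha_1; alpha_2; alpha], with alpha_1 < alpha_2 < 0 < alpha < 1. *)
Definition lambda1 (R : realType) (d : nat) : R := ((rootsR (charP R d))`_1)^-1.

Definition lambda3 (R : realType) (d : nat) : R := ((rootsR (charP R d))`_2)^-1.

Definition tmatrix (d : nat) : 'M[int]_3 :=
  \matrix_(i < 3, j < 3)
    (nth [::] [:: [:: 1; d%:Z; 1];
                  [:: 1; 0;    0];
                  [:: 0; 1;    0]] i)`_j.

Definition start_vector : 'cV[int]_3 := \col_(i < 3) [:: 2; 1; 0]`_i.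

Definition approx_vector (d k : nat) : 'cV[int]_3 :=
  tmatrix d ^+ k *m start_vector.

Definition s_ (d k : nat) : int := approx_vector d k (inord 0) 0.
Definition m_ (d k : nat) : int := approx_vector d k (inord 1) 0.
Definition n_ (d k : nat) : int := approx_vector d k (inord 2) 0.

(* [a `^ x] is the real power [expR (x * ln a)] for [0 < a]; every [s_ d k] is
   positive. *)
Definition error_product (R : realType) (d : nat) (alpha beta eta : R) (k : nat)
    : R :=
  (s_ d k)%:~R `^ eta
  * `|alpha - (m_ d k)%:~R / (s_ d k)%:~R|
  * `|beta - (n_ d k)%:~R / (s_ d k)%:~R|.

(* Main.v *)
Require Import Defs.
From mathcomp Require Import all_boot all_order all_algebra.
From mathcomp Require Import all_classical all_reals all_analysis.
From mathcomp Require Import polyrcf ring lra.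
Import Order.TTheory GRing.Theory Num.Theory.
Import numFieldNormedType.Exports.
Local Open Scope classical_set_scope.
Local Open Scope ring_scope.

(** Let [a1 < a2 < 0 < a < 1] be the roots of P(t) = t^3 + d t^2 + t - 1, so that
    [a < - a2 <= 1 < - a1].

    The point is [(a, a ^+ 2)] ([periodic_point]). On [triangle_k d] the Triangle
    Map is projectively linear, with eigenvalues [a1], [a2], [a]. Along the orbit,
    the quotient of the eigenform of [a1] (or [a2]) by that of [a] is multiplied
    at each step by a number of absolute value greater than 1. That quotient is
    bounded on the triangle, hence it is zero, and two vanishing linear forms
    determine the point.

    Since [m_k = s_(k-1)] and [n_k = s_(k-2)], both errors are governed by the one
    sequence [a * m_k - n_k] ([residual]): [|alpha - m_k / s_k|] and
    [|beta - n_k / s_k|] are combinations of two consecutive residuals, divided by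
    [s_k]. The denominator [s_k] is of exact order [a^-1 ^+ k]
    ([denominator_growth]), while the residual satisfies the second-order
    recurrence with eigenvalues [a2^-1] and [a1^-1] ([residual_rec]), hence is of
    order at most [rho ^+ k] with [rho = |a2^-1|] ([linear_rec2_bound]). So the
    error product is bounded by a geometric sequence of ratio
    [rho ^+ 2 * a^-1 `^ (eta - 2)], which is less than 1 exactly when
    [eta < 2 * (1 - ln rho / ln a^-1)] ([error_product_cvg0]).

    When [d = 3], P(t) = (t + 1)(t^2 + 2 t - 1), so [a2 = -1] and [a1 = - a^-1];
    the start vector has no component along the eigenvalue -1, the residual is
    [a * (- a) ^+ k], and one may take [rho = a], which gives [eta < 4]. *)

(** * Roots of the characteristic polynomial *)

Lemma horner_charP (R : realType) d (x : R) :
  (charP R d).[x] = x ^+ 3 + d%:R * x ^+ 2 + x - 1.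
Proof. by rewrite /charP !hornerE. Qed.

(** The elementary symmetric functions of [r], [b] and [c] are those of the
    roots of [charP R d]: the three numbers are its roots, with multiplicity. *)
Definition vieta (R : realType) (d : nat) (r b c : R) : Prop :=
  [/\ r + b + c = - d%:R, r * b + r * c + b * c = 1 & r * b * c = 1].

(** Location of the roots [a1 < a2 < 0 < a] of [charP R d]. The bounds
    [a2 < - a] and [a1 < -2] say that the positive root is the smallest in
    absolute value, and [-1 <= a2] separates [a2] from [a1]. *)
Lemma charP_roots (R : realType) (d : nat) : (3 <= d)%N ->
  exists a1 a2 a : R,
  [/\ rootsR (charP R d) = [:: a1; a2; a],
      [/\ a1 < -2, -1 <= a2, a2 < - a, 0 < a & a < 1] &
      vieta _ d a1 a2 a].
Proof.
move=> d3; have dR : (3 : R) <= d%:R by rewrite ler_nat.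
set P := charP R d.
have PE (x : R) : P.[x] = x ^+ 3 + d%:R * x ^+ 2 + x - 1 := horner_charP R d x.
have P0 : P.[0] < 0 by rewrite PE; lra.
have P1 : 0 < P.[1] by rewrite PE; lra.
have [a /itvP aI /rootP Pa] : {x | x \in `]0, 1[ & root P x}.
  by apply: polyrcf.poly_ivtoo; rewrite ?ler01 // nmulr_rlt0.
have a0 : 0 < a by rewrite aI.
have a1 : a < 1 by rewrite aI.
have Pna : P.[- a] < 0.
  have -> : P.[- a] = P.[a] - 2 * (a ^+ 3) - 2 * a by rewrite !PE; ring.
  by have := exprn_gt0 3 a0; rewrite Pa; lra.
have Pm1 : 0 <= P.[-1] by rewrite PE; lra.
have Pm2 : 0 < P.[-2] by rewrite PE; lra.
have Pmd : P.[- d%:R] < 0 by rewrite PE (_ : _ - 1 = - d%:R - 1); [lra|ring].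
(* the interval is closed because -1 is itself the root when d = 3 *)
have [a2 /itvP a2I ra2] : {x | x \in `[-1, -a] & root P x}.
  by apply: polyrcf.poly_ivt; [lra|rewrite mulr_ge0_le0 // ltW].
have Pa2 : P.[a2] = 0 by apply/rootP.
have a2N : a2 < - a.
  rewrite lt_neqAle a2I andbT; apply/eqP => E; move: Pna; rewrite -E Pa2; lra.
have a2m1 : -1 <= a2 by rewrite a2I.
have [b /itvP bI /rootP Pb] : {x | x \in `]- d%:R, -2[ & root P x}.
  by apply: polyrcf.poly_ivtoo; [lra|rewrite nmulr_rlt0].
have bm2 : b < -2 by rewrite bI.
have na : a - a2 != 0 by rewrite gt_eqF //; lra.
have nb : a2 - b != 0 by rewrite gt_eqF //; lra.
have nab : a - b != 0 by rewrite gt_eqF //; lra.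
move: (Pa) (Pa2) (Pb); rewrite !PE => Ea Ea2 Eb.
(* divided differences of the cubic *)
have D1 : a ^+ 2 + a * a2 + a2 ^+ 2 + d%:R * (a + a2) + 1 = 0.
  by apply: (mulfI na); rewrite mulr0 -[RHS](subrr 0) -{1}Ea -Ea2; ring.
have D2 : b ^+ 2 + b * a2 + a2 ^+ 2 + d%:R * (b + a2) + 1 = 0.
  by apply: (mulfI nb); rewrite mulr0 -[RHS](subrr 0) -{1}Ea2 -Eb; ring.
have V1 : b + a2 + a = - d%:R.
  apply: (mulfI nab); apply/eqP; rewrite -subr_eq0 -[X in _ == X](subrr 0).
  by rewrite -{1}D1 -D2; apply/eqP; ring.
have dE : d%:R = - (b + a2 + a) :> R by rewrite V1 opprK.
have V2 : b * a2 + b * a + a2 * a = 1 by move: D1; rewrite dE; lra.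
have V3 : b * a2 * a = 1.
  have : a * (b * a2 + b * a + a2 * a) = a by rewrite V2 mulr1.
  by move: Ea; rewrite dE; lra.
exists b, a2, a; split => //.
have Pn0 : P != 0 by apply/eqP => E; move: P0; rewrite E horner0 ltxx.
apply: (irr_sorted_eq lt_trans ltxx); rewrite ?sorted_roots //= ?andbT.
  by apply/andP; split; lra.
move=> x; rewrite -roots_on_rootsR // in_itv /= !inE rootE PE.
have -> : x ^+ 3 + d%:R * x ^+ 2 + x - 1 = (x - b) * ((x - a2) * (x - a)).
  transitivity (x ^+ 3 - (b + a2 + a) * x ^+ 2
                + (b * a2 + b * a + a2 * a) * x - b * a2 * a); last by ring.
  by rewrite V2 V3 V1; ring.
by rewrite !mulf_eq0 !subr_eq0.
Qed.

(** * The point with constant triangle sequence *)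

Lemma eq0_of_le_geometric (R : realType) (c K q : R) :
  `|q| < 1 -> (forall j, `|c| <= K * q ^+ j) -> c = 0.
Proof.
move=> q1 H; apply/eqP; rewrite -normr_le0.
by apply: (cvgr_to_ge (cvg_geometric K q1)); near=> j; exact: H.
Unshelve. all: by end_near.
Qed.

Lemma triangle_indexE (R : realType) k (p : R * R) :
  triangle_k k p -> triangle_index p = k.
Proof.
move=> kp; apply: xget_unique => // l [[_ _ y0] l1 l2].
case: kp => _ k1 k2.
have H (i j : nat) : 0 <= 1 - p.1 - i%:R * p.2 ->
    1 - p.1 - (j%:R + 1) * p.2 < 0 -> (i <= j)%N.
  move=> Hi Hj; rewrite -ltnS -(ltr_nat R) -(ltr_pM2r y0) -natr1; lra.
by apply/eqP; rewrite eqn_leq !H.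
Qed.

Section PeriodicPoint.
Context {R : realType}.
Implicit Types (r b c : R) (p : R * R) (d : nat).

(** On the line spanned by (1, x, y), for [p = (x, y)], the Triangle Map on
    [triangle_k d] is the linear map (1, x, y) -> (x, y, 1 - x - d y) up to the
    factor x. For eigenvalues [b] and [c] of that map, this is the value at
    (1, x, y) of the left eigenvector for the third eigenvalue. *)
Definition eigenform b c p := p.2 - (b + c) * p.1 + b * c.

Lemma eigenform_map d r b c p : vieta R d r b c -> triangle_k d p ->
  p.1 * eigenform b c (triangle_map p) = r * eigenform b c p.
Proof.
move=> [V1 V2 V3] kp; have [[_ yx y0] _ _] := kp.
have x0 : p.1 != 0 by rewrite gt_eqF // (lt_le_trans y0).
rewrite /eigenform /triangle_map (triangle_indexE _ _ _ kp) /=.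
transitivity (r * b * c - (r * b + r * c + b * c) * p.1 + (r + b + c) * p.2
              - (b + c) * p.2 + b * c * p.1); last by ring.
by rewrite V1 V2 V3; field.
Qed.

(** The eigenform of a root [r] with [a < - r] vanishes on a point whose orbit
    stays in [triangle_k d]: its quotient by the eigenform of [a] is multiplied
    by [r / a] at each step, yet it remains bounded because the eigenform of [a]
    is bounded below by the positive number [r * b]. *)
Lemma eigenform_eq0 d r b a p : vieta R d r b a -> r < 0 -> b < 0 -> 0 < a < - r ->
  has_triangle_sequence p (fun _ => d) -> eigenform b a p = 0.
Proof.
move=> V r0 b0 /andP[a0 ar] Hp; have [V1 V2 V3] := V.
have Va : vieta R d a r b by split; lra.
pose u j := iter j triangle_map p.
have u1 j : 0 < (u j).1.
  by case: (Hp j) => -[_ yx y0 _ _]; exact: lt_le_trans y0 yx.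
(* the quotient of the two eigenforms grows by r / a, with denominators cleared *)
have cross j : a ^+ j * (eigenform r b p * eigenform b a (u j)) =
               r ^+ j * (eigenform b a p * eigenform r b (u j)).
  elim: j => [|j IH]; first by rewrite !expr0 !mul1r mulrC.
  apply: (mulfI (lt0r_neq0 (u1 j))).
  have E1 := eigenform_map _ _ _ _ _ V (Hp j).
  have E2 := eigenform_map _ _ _ _ _ Va (Hp j).
  rewrite -!/(u _) in E1 E2.
  have -> : u j.+1 = triangle_map (u j) by [].
  rewrite !exprS.
  transitivity (a * a ^+ j * eigenform r b p *
                ((u j).1 * eigenform b a (triangle_map (u j)))); first by ring.
  transitivity (r * r ^+ j * eigenform b a p *
                ((u j).1 * eigenform r b (triangle_map (u j)))); last by ring.
  rewrite E1 E2; move: IH; set A := eigenform b a p; set B := eigenform r b p.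
  set A' := eigenform b a _; set B' := eigenform r b _ => IH.
  transitivity (a * r * (a ^+ j * (B * A'))); first by ring.
  by rewrite IH; ring.
have rb : 0 < r * b by rewrite nmulr_lgt0.
have pos j : r * b <= eigenform r b (u j).
  case: (Hp j) => -[_ _ y0] _ _; have := u1 j; rewrite -/(u j) in y0.
  have : r + b < 0 by lra.
  by rewrite /eigenform; nra.
pose K := 1 + `|b + a| + `|b * a|.
have bnd j : `|eigenform b a (u j)| <= K.
  case: (Hp j) => -[x1 yx y0] _ _; have := u1 j; rewrite -/(u j) in y0 x1 yx => x0.
  rewrite /eigenform /K; apply: le_trans (ler_normD _ _) _; rewrite lerD2r.
  apply: le_trans (ler_normB _ _) _; rewrite gtr0_norm // normrM (gtr0_norm x0).
  by rewrite lerD // ?(le_trans yx) // ler_piMr.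
have rn0 : 0 < `|r| by rewrite normr_gt0 lt_eqF.
apply: (@eq0_of_le_geometric _ _ (eigenform r b p * K / (r * b)) (a / `|r|)).
  by rewrite ger0_norm ?divr_ge0 ?ltW // ltr_pdivrMr // mul1r ltr0_norm.
move=> j; rewrite mulrAC ler_pdivlMr // expr_div_n [leRHS]mulrA.
rewrite ler_pdivlMr ?exprn_gt0 //.
have E0 : 0 < eigenform r b p := lt_le_trans rb (pos 0%N).
apply: (@le_trans _ _ (`|eigenform b a p| * eigenform r b (u j) * `|r| ^+ j)).
  by rewrite ler_wpM2r ?exprn_ge0 // ler_wpM2l.
have -> : `|eigenform b a p| * eigenform r b (u j) * `|r| ^+ j =
          `|r ^+ j * (eigenform b a p * eigenform r b (u j))|.
  by rewrite !normrM normrX (gtr0_norm (lt_le_trans rb (pos j))); ring.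
rewrite -cross !normrM normrX (gtr0_norm a0) (gtr0_norm E0).
rewrite [leRHS]mulrC ler_wpM2l ?exprn_ge0 ?(ltW a0) //.
by rewrite ler_wpM2l // ltW.
Qed.

(** The two eigenforms of the negative roots vanish at [p], which determines
    [p]. *)
Lemma periodic_point d a1 a2 a p : vieta R d a1 a2 a ->
  a1 < a2 -> a2 < - a -> 0 < a ->
  has_triangle_sequence p (fun _ => d) -> p.1 = a /\ p.2 = a ^+ 2.
Proof.
move=> V a12 a2a a0 Hp; have [V1 V2 V3] := V.
have V' : vieta R d a2 a1 a by split; lra.
have E1 : eigenform a2 a p = 0 by apply: (eigenform_eq0 _ _ _ _ _ V) => //; lra.
have E2 : eigenform a1 a p = 0 by apply: (eigenform_eq0 _ _ _ _ _ V') => //; lra.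
rewrite /eigenform in E1 E2.
suff Ea : p.1 = a by split => //; move: E1; rewrite Ea; lra.
apply: (mulfI (x := a2 - a1)); first by rewrite gt_eqF // subr_gt0.
by move: E1 E2; lra.
Qed.
End PeriodicPoint.

(** * The rational approximations *)

Lemma approx_vectorS d k :
  [/\ s_ d k.+1 = s_ d k + d%:Z * m_ d k + n_ d k,
      m_ d k.+1 = s_ d k & n_ d k.+1 = m_ d k].
Proof.
have H (i : 'I_3) : approx_vector d k.+1 i 0 =
    \sum_j tmatrix d i j * approx_vector d k j 0.
  by rewrite /approx_vector exprS -mulmxA mxE.
rewrite /s_ /m_ /n_ !H !big_ord_recl !big_ord0 !mxE /= !inordK //=.
have -> : @inord 2 0 = ord0 by apply/val_inj; rewrite /= inordK.
have -> : @inord 2 1 = lift ord0 ord0 by apply/val_inj; rewrite /= inordK.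
have -> : @inord 2 2 = lift ord0 (lift ord0 ord0)
  by apply/val_inj; rewrite /= inordK.
by split; ring.
Qed.

Lemma approx_vector0 d : [/\ s_ d 0 = 2, m_ d 0 = 1 & n_ d 0 = 0].
Proof.
by rewrite /s_ /m_ /n_ /approx_vector expr0 mul1mx !mxE !inordK.
Qed.

Section Convergents.
Context {R : realType} (d : nat) (a : R).
Context (a_gt0 : 0 < a) (a_lt1 : a < 1).
Context (a_root : a ^+ 3 + d%:R * a ^+ 2 + a = 1).

Let S k : R := (s_ d k)%:~R.
Let M k : R := (m_ d k)%:~R.
Let N k : R := (n_ d k)%:~R.

(** The linear form [a * m_k - n_k]. Since [n_(k+1) = m_k] and [m_(k+1) = s_k],
    its value at [k.+1] is [a * s_k - m_k], the numerator of the error on [a],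
    and [a ^+ 2 * s_k - n_k = a * residual k.+1 + residual k]. *)
Definition residual (k : nat) : R := a * (m_ d k)%:~R - (n_ d k)%:~R.

Let SS k : S k.+1 = S k + d%:R * M k + N k.
Proof.
by rewrite /S; have [-> _ _] := approx_vectorS d k; rewrite !rmorphD rmorphM.
Qed.
Let MS k : M k.+1 = S k.
Proof. by rewrite /M; have [_ -> _] := approx_vectorS d k. Qed.
Let NS k : N k.+1 = M k.
Proof. by rewrite /N; have [_ _ ->] := approx_vectorS d k. Qed.
Let init : [/\ S 0 = 2, M 0 = 1 & N 0 = 0].
Proof. by rewrite /S /M /N; have [-> -> ->] := approx_vector0 d. Qed.

Lemma residual0 : residual 0 = a.
Proof.
by rewrite /residual -/(M _) -/(N _); have [_ -> ->] := init; lra.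
Qed.

Lemma residualS k : residual k.+1 = a * (s_ d k)%:~R - (m_ d k)%:~R.
Proof. by rewrite /residual -/(M _) -/(N _) MS NS. Qed.

(** The residual has no component along [a^-1], and so obeys the recurrence of
    the two other eigenvalues, with sum [1 - a^-1] and product [a]. *)
Lemma residual_rec k : residual k.+2 = (1 - a^-1) * residual k.+1 - a * residual k.
Proof.
have a0 := lt0r_neq0 a_gt0; apply: (mulfI a0).
rewrite !residualS /residual -/(S _) -/(M _) -/(N _) -/(S _) -/(M _) SS MS.
transitivity (a ^+ 2 * S k - a * S k + (d%:R * a ^+ 2) * M k + a ^+ 2 * N k).
  by ring.
have -> : d%:R * a ^+ 2 = 1 - a - a ^+ 3 by move: a_root; lra.
by field.
Qed.

Lemma convergent_bounds k :
  [/\ 1 <= (s_ d k)%:~R :> R, 0 <= ((m_ d k)%:~R : R) <= (s_ d k)%:~R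
    & 0 <= ((n_ d k)%:~R : R) <= (s_ d k)%:~R].
Proof.
rewrite -/(S _) -/(M _) -/(N _).
elim: k => [|k [S1 /andP[M0 MS'] /andP[N0 NS']]].
  by have [-> -> ->] := init; split; lra.
have dM : 0 <= d%:R * M k by rewrite mulr_ge0.
by rewrite SS MS NS; split; lra.
Qed.

(* left eigenvector of the matrix for the eigenvalue 1/a *)
Let form k := S k + (a^-1 - 1) * M k + a * N k.

Let form_geometric k : form k = a^-1 ^+ k * form 0.
Proof.
elim: k => [|k IH]; first by rewrite expr0 mul1r.
have a0 := lt0r_neq0 a_gt0.
rewrite exprS -mulrA -IH /form SS MS NS; apply: (mulfI (expf_neq0 2 a0)).
transitivity (a * S k + (d%:R * a ^+ 2 + a ^+ 3) * M k + a ^+ 2 * N k).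
  by field.
have -> : d%:R * a ^+ 2 + a ^+ 3 = 1 - a by move: a_root; lra.
by field.
Qed.

(** The form [s + (a^-1 - 1) * m + a * n] lies between [s] and [(a^-1 + a) * s],
    and it is exactly geometric of ratio [a^-1]. *)
Lemma denominator_growth : exists c C : R, [/\ 0 < c, 0 < C &
  forall k, c * a^-1 ^+ k <= (s_ d k)%:~R <= C * a^-1 ^+ k].
Proof.
have ai1 : 1 < a^-1 by rewrite invf_gt1.
have F0 : 0 < form 0 by rewrite /form; have [-> -> ->] := init; lra.
have D0 : 0 < a^-1 + a by rewrite addr_gt0 ?invr_gt0.
exists (form 0 / (a^-1 + a)), (form 0); split=> // [|k]; first exact: divr_gt0.
have [] := convergent_bounds k; rewrite -/(S _) -/(M _) -/(N _).
move=> S1 /andP[M0 MS'] /andP[N0 NS'].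
rewrite mulrAC ler_pdivrMr // [form 0 * _]mulrC -form_geometric /form.
have H1 : 0 <= (a^-1 - 1) * M k <= (a^-1 - 1) * S k.
  by rewrite mulr_ge0 ?ler_wpM2l // subr_ge0 ltW.
have H2 : 0 <= a * N k <= a * S k by rewrite mulr_ge0 ?ler_wpM2l // ltW.
lra.
Qed.

(** If the residual is at most of the order of [rho ^+ k], the error product is
    at most of the order of the [k]-th power of [rho ^+ 2 * a^-1 `^ (eta - 2)]. *)
Lemma error_product_cvg0 (K rho eta : R) : 0 < rho ->
  (forall k, `|residual k| <= K * rho ^+ k) ->
  0 <= eta -> 2 * ln rho + (eta - 2) * ln a^-1 < 0 ->
  error_product d a (a ^+ 2) eta k @[k --> \oo] --> (0 : R).
Proof.
move=> rho0 Hres eta0 small.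
have [c [C [c0 C0 Sb]]] := denominator_growth.
have ai0 : 0 < a^-1 by rewrite invr_gt0.
pose q := rho ^+ 2 * a^-1 `^ eta / a^-1 ^+ 2.
have q0 : 0 < q by rewrite !(mulr_gt0, invr_gt0, exprn_gt0, powR_gt0).
have q1 : q < 1.
  rewrite -ltr_ln ?posrE // ln1 /q ln_div ?lnM ?lnXn ?ln_powR ?posrE;
    rewrite ?(mulr_gt0, exprn_gt0, powR_gt0) //.
  move: small; lra.
pose B := C `^ eta * (K * rho) * (K * (a * rho + 1)) / c ^+ 2.
apply: (@squeeze_cvgr _ _ _ _ (cst 0) (geometric B q)); last 2 first.
- exact: cvg_cst.
- by apply: cvg_geometric; rewrite ger0_norm // ltW.
near=> k; rewrite /error_product /=.
have [S1 _ _] := convergent_bounds k; have /andP[Sl Su] := Sb k.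
have S0 : 0 < (s_ d k)%:~R :> R by lra.
rewrite !mulr_ge0 ?powR_ge0 //=.
have lk0 : 0 < a^-1 ^+ k by rewrite exprn_gt0.
have P1 : (s_ d k)%:~R `^ eta <= C `^ eta * (a^-1 `^ eta) ^+ k.
  rewrite -powR_mulrn ?powR_ge0 // -powRrM [eta * _]mulrC powRrM.
  rewrite powR_mulrn ?(ltW ai0) //.
  rewrite -powRM ?(ltW C0) ?(ltW lk0) //.
  apply: ge0_ler_powR; rewrite ?nnegrE ?(ltW S0) //.
  by rewrite mulr_ge0 ?(ltW C0) ?(ltW lk0).
have Sinv : (s_ d k)%:~R^-1 <= (c * a^-1 ^+ k)^-1.
  by rewrite lef_pV2 ?posrE ?mulr_gt0.
have E1 : `|a - (m_ d k)%:~R / (s_ d k)%:~R| <=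
          K * rho * rho ^+ k / (c * a^-1 ^+ k).
  rewrite (_ : a - _ = residual k.+1 / (s_ d k)%:~R); last first.
    by rewrite residualS; field; rewrite gt_eqF.
  rewrite normrM normfV (gtr0_norm S0) ler_pM ?invr_ge0 ?(ltW S0) //.
  by rewrite -mulrA -exprS.
have E2 : `|a ^+ 2 - (n_ d k)%:~R / (s_ d k)%:~R| <=
          K * (a * rho + 1) * rho ^+ k / (c * a^-1 ^+ k).
  rewrite (_ : a ^+ 2 - _ = (a * residual k.+1 + residual k) / (s_ d k)%:~R);
    last by rewrite residualS /residual; field; rewrite gt_eqF.
  rewrite normrM normfV (gtr0_norm S0) ler_pM ?invr_ge0 ?(ltW S0) //.
  apply: le_trans (ler_normD _ _) _; rewrite normrM (gtr0_norm a_gt0).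
  have := ler_wpM2l (ltW a_gt0) (Hres k.+1); have := Hres k; rewrite exprS; lra.
apply: (@le_trans _ _ ((C `^ eta * (a^-1 `^ eta) ^+ k)
   * (K * rho * rho ^+ k / (c * a^-1 ^+ k))
   * (K * (a * rho + 1) * rho ^+ k / (c * a^-1 ^+ k)))).
  by rewrite !ler_pM ?mulr_ge0 ?powR_ge0.
rewrite /B /q !exprMn !exprVn -!exprM !(mulnC 2) !exprM.
rewrite le_eqVlt; apply/orP; left; apply/eqP; field.
by rewrite !gt_eqF ?exprn_gt0.
Unshelve. all: by end_near.
Qed.

End Convergents.

Lemma linear_rec2_bound (R : realType) (f : nat -> R) (x y : R) :
  x != y -> `|y| <= `|x| ->
  (forall k, f k.+2 = (x + y) * f k.+1 - x * y * f k) ->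
  exists K, forall k, `|f k| <= K * `|x| ^+ k.
Proof.
move=> xy yx rec.
(* removing the v-component leaves a geometric sequence of ratio u *)
have geom u v : (forall k, f k.+2 = (u + v) * f k.+1 - u * v * f k) ->
    forall k, f k.+1 - v * f k = u ^+ k * (f 1%N - v * f 0%N).
  move=> H; elim=> [|k IH]; first by rewrite expr0 mul1r.
  by rewrite H exprS -[RHS]mulrA -IH; ring.
have Gx := geom x y rec.
have Gy : forall k, f k.+1 - x * f k = y ^+ k * (f 1%N - x * f 0%N).
  by apply: geom => k; rewrite rec; ring.
set A := f 1%N - y * f 0%N in Gx; set B := f 1%N - x * f 0%N in Gy.
have xy0 : 0 < `|x - y| by rewrite normr_gt0 subr_eq0.
exists ((`|A| + `|B|) / `|x - y|) => k.
rewrite mulrAC ler_pdivlMr // -normrM.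
have -> : f k * (x - y) = x ^+ k * A - y ^+ k * B by rewrite -Gx -Gy; ring.
apply: le_trans (ler_normB _ _) _; rewrite !normrM !normrX mulrDl.
by rewrite mulrC lerD2l mulrC ler_wpM2l // lerXn2r ?nnegrE.
Qed.

(** * The limit *)

Theorem corollary8p3 (R : realType) (d : nat) (alpha beta : R)
  (d_ge3 : (3 <= d)%N)
  (in_triangle : closed_triangle (alpha, beta))
  (irr : irrational alpha \/ irrational beta)
  (seq_d : has_triangle_sequence (alpha, beta) (fun _ => d)) :
  ((4 <= d)%N -> forall eta : R,
     eta < 2 * (1 - ln `|lambda1 R d| / ln (lambda3 R d)) ->
     error_product d alpha beta eta k @[k --> \oo] --> (0 : R)) /\
  (d = 3%N -> forall eta : R,
     eta < 4 ->
     error_product d alpha beta eta k @[k --> \oo] --> (0 : R)).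
Proof.
have [a1 [a2 [a [roots [a1_lt a2_ge a2_lt a_gt0 a_lt1] V]]]]
  := charP_roots R d d_ge3.
have [V1 V2 V3] := V.
have a12 : a1 < a2 by lra.
have [/= -> ->] := periodic_point _ _ _ _ _ V a12 a2_lt a_gt0 seq_d.
have a_root : a ^+ 3 + d%:R * a ^+ 2 + a = 1.
  have -> : d%:R = - (a1 + a2 + a) by rewrite V1 opprK.
  have : a * (a1 * a2 + a1 * a + a2 * a) = a by rewrite V2 mulr1.
  by lra.
have lnai : 0 < ln a^-1 by rewrite ln_gt0 // invf_gt1.
have l2 : 0 < `|a2^-1| by rewrite normr_gt0 invr_eq0 lt_eqF //; lra.
(* error products increase with the exponent, since s_k >= 1 *)
have mono (eta : R) :
    error_product d a (a ^+ 2) (Num.max eta 0) k @[k --> \oo] --> (0 : R) ->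
    error_product d a (a ^+ 2) eta k @[k --> \oo] --> (0 : R).
  apply: (@squeeze_cvgr _ _ _ _ (cst 0)); last exact: cvg_cst.
  near=> k; rewrite /error_product !mulr_ge0 ?powR_ge0 //=.
  have [S1 _ _] := @convergent_bounds R d k.
  by rewrite !ler_wpM2r // ler_powR // le_max lexx.
split=> [d4|d3] eta eta_lt; apply: mono.
- rewrite /lambda1 /lambda3 roots /= in eta_lt.
  have i1 : a1^-1 = a2 * a by apply: mulr1_eq; rewrite mulrA.
  have i2 : a2^-1 = a1 * a by apply: mulr1_eq; rewrite mulrCA mulrA.
  have i3 : a^-1 = a1 * a2 by apply: mulr1_eq; rewrite mulrC.
  have [K HK] : exists K, forall k, `|residual d a k| <= K * `|a2^-1| ^+ k.
    apply: (@linear_rec2_bound _ _ _ a1^-1) => [||k].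
    + by rewrite (inj_eq (can_inj invrK)) gt_eqF.
    + rewrite !normfV lef_pV2 ?posrE ?normr_gt0 ?lt_eqF //; try lra.
      by rewrite !ltr0_norm; lra.
    + rewrite (residual_rec d a a_gt0 a_root) i1 i2 i3; congr (_ * _ - _ * _).
        by lra.
      by rewrite -[LHS]mul1r -[in LHS]V3; ring.
  apply: (error_product_cvg0 d a a_gt0 a_lt1 a_root _ _ _ l2 HK).
    by rewrite le_max lexx orbT.
  have lt23 : ln `|a2^-1| < ln a^-1.
    rewrite ltr_ln ?posrE ?invr_gt0 // normfV.
    rewrite ltf_pV2 ?posrE ?normr_gt0 ?lt_eqF //; try lra.
    by rewrite ltr0_norm; lra.
  have : eta * ln a^-1 < 2 * (ln a^-1 - ln `|a2^-1|).
    rewrite -ltr_pdivlMr // -mulrA; congr (_ < _ * _): eta_lt.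
    by rewrite mulrBl divff // gt_eqF.
  by case: (leP eta 0) => _; lra.
- (* P = (t + 1)(t ^ 2 + 2 t - 1) when d = 3 *)
  have a_quad : a ^+ 2 + 2 * a = 1.
    apply/eqP; rewrite -subr_eq0; apply/eqP.
    apply: (mulfI (x := a + 1)); first by rewrite gt_eqF // addr_gt0.
    by rewrite mulr0; move: a_root; rewrite d3; lra.
  have ai : a^-1 = a + 2 by apply: mulr1_eq; rewrite mulrDr mulrC; lra.
  (* the start vector has no component along the eigenvalue -1 *)
  have res k : residual d a k = a * (- a) ^+ k /\
               residual d a k.+1 = a * (- a) ^+ k.+1.
    elim: k => [|k [IH1 IH2]].
      rewrite residual0 residualS; have [-> -> _] := approx_vector0 d.
      by rewrite expr0 expr1; split; lra.
    split=> //; rewrite (residual_rec d a a_gt0 a_root) IH1 IH2 ai !exprS; ring.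
  apply: (error_product_cvg0 d a a_gt0 a_lt1 a_root a a _ a_gt0).
  + move=> k; have [-> _] := res k.
    by rewrite normrM normrX normrN (gtr0_norm a_gt0).
  + by rewrite le_max lexx orbT.
  + rewrite lnV ?posrE // in lnai *.
    have : Num.max eta 0 < 4 by rewrite gt_max eta_lt ltr0n.
    by set e := Num.max _ _; nra.
Unshelve. all: by end_near.
Qed.
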